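(* Let $H=(V,E)$ be a hypergraph of rank $3$, and define $g:E\to\mathbb{R}$ by $g(e)=\frac{1}{|e|-1+1/|e|}$ for every edge $e$. Then $g$ is good for $H$.
   Context: A hypergraph $H=(V,E)$ consists of a finite vertex set $V$ and a finite set $E$ of nonempty subsets of $V$ (edges); its rank is the largest size of an edge. For an edge $e$, $N(e)=\{f\in E: f\neq e,\ f\cap e\neq\emptyset\}$. A fractional matching of $H$ is a function $x:E\to[0,1]$ with $\sum_{e\ni v}x(e)\le 1$ for every $v\in V$; it is basic if it is an extreme point of the polytope of fractional matchings of $H$. Given $g:E\to\mathbb{R}$, a basic fractional matching $x$ of $H$ is stuck for $g$ if for every $e\in E$, $\sum_{f\in N(e)}g(f)x(f)>1-g(e)x(e)$. A subgraph of $H$ is a hypergraph $H'=(V,E')$ with $E'\subseteq E$ (neighborhoods and fractional matchings are then taken in $H'$, and $g$ is restricted to $E'$); it is non-empty if $E'\neq\emptyset$. The function $g$ is good for $H$ if no non-empty subgraph of $H$ has a basic fractional matching that is stuck for $g$. *)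

(* Defs.v *)
From mathcomp Require Import all_boot all_order all_algebra.

Set Implicit Arguments.
Unset Strict Implicit.
Unset Printing Implicit Defensive.

Import Order.TTheory GRing.Theory Num.Theory.
Local Open Scope ring_scope.

Record hypergraph (V : finType) := Hypergraph {
  edges : {set {set V}};
  edges_nonempty : set0 \notin edges
}.

Definition rank (V : finType) (H : hypergraph V) : nat :=
  (\max_(e in edges H) #|e|)%N.

Definition subgraph (V : finType) (H' H : hypergraph V) : Prop :=
  edges H' \subset edges H.

(* The finite type of edges, so that [{ffun edge H -> R}] is the space of
   real vectors indexed by the edge set. *)
Notation edge H := {e | e \in edges H}.

Definition neighbors (V : finType) (H : hypergraph V) (e : edge H) :
    {set edge H} :=
  [set f : edge H | (f != e) && (val f :&: val e != set0)].

Definition fractional_matching (R : numDomainType) (V : finType)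
    (H : hypergraph V) (x : {ffun edge H -> R}) : Prop :=
  (forall e, 0 <= x e <= 1) /\
  (forall v : V, \sum_(e : edge H | v \in val e) x e <= 1).

Definition extreme_point (R : numDomainType) (M : lmodType R) (P : M -> Prop)
    (x : M) : Prop :=
  P x /\
  forall (y z : M) (t : R), P y -> P z -> 0 < t < 1 ->
    x = t *: y + (1 - t) *: z -> y = x /\ z = x.

(* [R^o] is [R] viewed as a module over itself, which gives [{ffun edge H -> R}]
   its vector space structure. *)
Definition basic_fractional_matching (R : numDomainType) (V : finType)
    (H : hypergraph V) (x : {ffun edge H -> R}) : Prop :=
  extreme_point (M := {ffun edge H -> R^o}) (@fractional_matching R V H) x.

(* [g] is defined on all subsets of [V], but only its values on the edges of
   [H] are used; its restriction to a subgraph is thus [g] itself. *)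
Definition stuck (R : numDomainType) (V : finType) (H : hypergraph V)
    (g : {set V} -> R) (x : {ffun edge H -> R}) : Prop :=
  forall e : edge H,
    \sum_(f in neighbors e) g (val f) * x f > 1 - g (val e) * x e.

Definition good (R : numDomainType) (V : finType) (H : hypergraph V)
    (g : {set V} -> R) : Prop :=
  forall H' : hypergraph V, subgraph H' H -> edges H' != set0 ->
    ~ exists x : {ffun edge H' -> R},
        basic_fractional_matching x /\ stuck g x.

(* Main.v *)
Require Import Defs.
From mathcomp Require Import all_boot all_order all_algebra.
From mathcomp Require Import reals.
From mathcomp Require Import ring lra.
Import Order.TTheory GRing.Theory Num.Theory.
Local Open Scope ring_scope.

Set Implicit Arguments.
Unset Strict Implicit.
Unset Printing Implicit Defensive.

(** Let [x] be basic and stuck. A singleton edge is never stuck, so only edges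
    of size 2 and 3 remain; write [a v], [b v] for their loads at [v] and
    [d = a + b <= 1]. Being stuck then implies
      [21 + 14 x e < \sum_(v in e) (9 d v + 5 a v)] if [|e| = 2],
      [21 + 18 x e < \sum_(v in e) (9 d v + 5 a v)] if [|e| = 3].
    Basicness gives at least as many tight vertices ([d v = 1]) as edges in the
    support. Weighting the inequalities of the 3-edges by [x], and using
    [18 x^2 >= 12 x - 2], one gets [2 n <= \sum_v a v (7 - 5 a v)], where [n] is
    the number of 2-edges in the support. The opposite strict inequality follows
    from the 2-edge inequalities by discharging along the 2-edges. *)

(** * Linear algebra for perturbing a point of a polytope *)

Lemma underdetermined_kernel (K : fieldType) (E V : finType) (P : {set E})
    (T : {set V}) (m : E -> V -> K) :
  (#|T| < #|P|)%N ->
  exists y : E -> K, [/\ exists e, y e != 0, forall e, e \notin P -> y e = 0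
    & forall v, v \in T -> \sum_e y e * m e v = 0].
Proof.
move=> ltTP.
pose A : 'M[K]_(#|P|, #|T|) := \matrix_(i, j) m (enum_val i) (enum_val j).
have : kermx A != 0.
  rewrite -mxrank_eq0 mxrank_ker subn_eq0 -ltnNge.
  exact: leq_ltn_trans (rank_leq_col A) ltTP.
case/rowV0Pn => u /sub_kermxP uA /rV0Pn [i ui].
(* At most one [j] enumerates to [e], so [y] is [u] extended by zero outside [P]. *)
pose y e := \sum_(j | enum_val j == e) u 0 j.
exists y; split.
- exists (enum_val i); rewrite /y (big_pred1 i) // => j /=.
  by rewrite (inj_eq enum_val_inj).
- move=> e eP; rewrite /y big1 // => j /eqP ej.
  by move: eP; rewrite -ej enum_valP.
move=> v vT; have /rowP/(_ (enum_rank_in vT v)) := uA.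
rewrite !mxE => uAv; apply: etrans uAv; rewrite /y.
under eq_bigr do rewrite big_distrl /=.
rewrite (exchange_big_dep predT) //=; apply: eq_bigr => j _.
rewrite (big_pred1 (enum_val j)) => [|e]; last by rewrite eq_sym.
by rewrite mxE (enum_rankK_in vT).
Qed.

Lemma exists_uniform_scale (R : realFieldType) (I : finType) (c w : I -> R) :
  (forall i, 0 <= c i) -> (forall i, c i = 0 -> w i = 0) ->
  exists2 eps, 0 < eps & forall i, eps * `|w i| <= c i.
Proof.
(* Division by zero gives 0, so indices with [c i = 0] contribute nothing to the sum of ratios. *)
move=> c0 cw; pose r i := `|w i| / c i.
have r0 i : 0 <= r i by rewrite divr_ge0.
have S0 : 0 <= \sum_i r i by apply: sumr_ge0.
have S1 : 0 < 1 + \sum_i r i by apply: ltr_pwDl.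
exists (1 + \sum_i r i)^-1 => [|i]; first by rewrite invr_gt0.
case: (eqVneq (c i) 0) => [ci0|ci0]; first by rewrite cw // ci0 normr0 mulr0.
have -> : `|w i| = r i * c i by rewrite divfK.
rewrite mulrA ler_piMl // mulrC ler_pdivrMr // mul1r (bigD1 i) //=.
by rewrite addrCA ler_wpDr // addr_ge0 // sumr_ge0.
Qed.

(** * Discharging along the edges of a graph *)

Section Discharging.
Context (R : realFieldType) (V E : finType) (ends : E -> {set V}) (x : E -> R).
Context (F : {set E}).

Definition load (v : V) : R := \sum_(e in F | v \in ends e) x e.
Definition degree (v : V) : nat := #|[set e in F | v \in ends e]|.
Definition slack (v : V) : R := 1 - load v.
(** Chosen so that [load v * (7 - 5 * load v) = 2 - excess v]. *)
Definition excess (v : V) : R := 5 * slack v ^+ 2 - 3 * slack v.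

(* A vertex of degree at least 3 has room to pay for its neighbours of degree 1
   and 2, which cannot be adjacent to each other. The terms [slack v / 5] and
   [other / 2] cost nothing: summing [crowded_slack] over the two edges at a
   vertex of degree 2 gives [5 * (sum of others) <= 4 * slack v]. *)
Definition charge (v : V) (e : E) : R :=
  let other := \sum_(w in ends e) slack w - slack v in
  if (degree v <= 1)%N then 1 - excess v
  else if degree v == 2 then
    - excess v / 2 + slack v / 5 - other / 2
  else - (1 + excess v) / 3.

Hypothesis ends2 : forall e, e \in F -> #|ends e| = 2.
Hypothesis x_gt0 : forall e, e \in F -> 0 < x e.
Hypothesis load_le1 : forall v, load v <= 1.
Hypothesis crowded :
  forall e, e \in F -> 3 + 14 * x e < 5 * \sum_(v in ends e) load v.

Lemma sum_degree (c : R) v :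
  \sum_(e in F | v \in ends e) c = (degree v)%:R * c.
Proof. by rewrite mulr_natl -sumr_const; apply: eq_bigl => e; rewrite inE. Qed.

Lemma slack_ge0 v : 0 <= slack v.
Proof. by rewrite subr_ge0. Qed.

Lemma load_ge0 v : 0 <= load v.
Proof. by apply: sumr_ge0 => e /andP[/x_gt0/ltW]. Qed.

Lemma crowded_slack e : e \in F ->
  5 * \sum_(v in ends e) slack v < 7 - 14 * x e.
Proof.
move=> eF; have := crowded eF.
rewrite /slack sumrB sumr_const ends2 //; lra.
Qed.

(** [charge] shares out [2 - excess v - degree v] among the edges at [v]. From degree 3 on, the
    error is a third of [(degree v - 3) * (2 - excess v)], which is nonnegative. *)
Lemma charge_degree v :
  load v * (7 - 5 * load v) - (degree v)%:R <=
  \sum_(e in F | v \in ends e) charge v e.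
Proof.
have l0 := load_ge0 v; have l1 := load_le1 v.
rewrite /charge; case: (leqP (degree v) 1) => d1.
  rewrite sum_degree /excess /slack.
  case dv: (degree v) d1 => [|[|//]] _; last by nra.
  have -> : load v = 0; last by lra.
  rewrite /load big1 // => e /andP[eF ve].
  by move/eqP: dv; rewrite cards_eq0 => /eqP/setP/(_ e); rewrite !inE eF ve.
case: (eqVneq (degree v) 2) => d2.
  have H : \sum_(e in F | v \in ends e) 5 * (\sum_(w in ends e) slack w) <=
     \sum_(e in F | v \in ends e) (7 - 14 * x e).
    by apply: ler_sum => e /andP[eF _]; apply/ltW/crowded_slack.
  move: H; rewrite big_split /= sum_degree sumrN -!mulr_sumr -/(load v).
  rewrite big_split /= sum_degree sumrN -mulr_suml sumrB sum_degree d2.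
  rewrite /excess /slack; lra.
rewrite sum_degree.
have d3 : 3 <= (degree v)%:R :> R.
  by rewrite ler_nat; case: (degree v) d1 d2 => [|[|[|]]].
have e2 : excess v <= 2 by rewrite /excess /slack; nra.
have : 0 <= ((degree v)%:R - 3) * (2 - excess v) by rewrite mulr_ge0 ?subr_ge0.
rewrite /excess /slack; lra.
Qed.

Lemma degree1_load v e : e \in F -> v \in ends e -> (degree v <= 1)%N ->
  load v = x e.
Proof.
move=> eF ve d1; rewrite /load (big_pred1 e) // => f /=.
have de : [set e] \subset [set f in F | v \in ends f].
  by rewrite sub1set inE eF ve.
have /eqP/setP/(_ f) : [set e] == [set f in F | v \in ends f].
  by rewrite eqEcard de cards1.
by rewrite !inE => ->.
Qed.

(** The other edge [f] at [v] has [14 * x f < 7 - 5 * slack v], while [x e + x f = 1 - slack v]. *)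
Lemma degree2_slack v e : e \in F -> v \in ends e -> degree v = 2 ->
  7 - 14 * x e <= 9 * slack v.
Proof.
move=> eF ve d2.
have : \sum_(f in F | v \in ends f) (5 * slack v - 7 + 14 * x f) <=
  5 * slack v - 7 + 14 * x e.
  rewrite (bigD1 e) ?eF //= gerDl sumr_le0 // => f /andP[/andP[fF vf] _].
  have := crowded_slack fF; rewrite (bigD1 v) //=.
  have : 0 <= \sum_(i in ends f | i != v) slack i.
    by apply: sumr_ge0 => w _; apply: slack_ge0.
  lra.
rewrite big_split /= sum_degree d2 -mulr_sumr -/(load v) /slack; lra.
Qed.

(** Settles an edge from a vertex of degree 1 and slack [s] to one of degree at least 3 and slack
    [t]. *)
Lemma leaf_charge (s t : R) : 0 <= t -> 7 + 5 * t < 9 * s ->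
  1 - (5 * s ^+ 2 - 3 * s) - (1 + (5 * t ^+ 2 - 3 * t)) / 3 < 0.
Proof.
move=> t0 st.
(* The product is 81 times the growth of [5 * s ^+ 2 - 3 * s] from [(7 + 5 * t) / 9] to [s]. *)
have : 0 < (9 * s - 7 - 5 * t) * (45 * s + 8 + 25 * t) by apply: mulr_gt0; lra.
have := sqr_ge0 t; lra.
Qed.

Lemma degree2_charge (s t : R) : 0 <= s -> 0 <= t ->
  - (5 * s ^+ 2 - 3 * s) / 2 + s / 5 - t / 2
    - (1 + (5 * t ^+ 2 - 3 * t)) / 3 < 0.
Proof.
(* The left side is separable and concave, with its maximum [- 41 / 6000] at [s = 17 / 50],
   [t = 3 / 20]. *)
move=> s0 t0; have := sqr_ge0 (s - 17 / 50); have := sqr_ge0 (t - 3 / 20); lra.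
Qed.

(** If both ends have degree at most 2, then [crowded_slack] is contradicted, so some end has degree
    at least 3 and pays for the other. *)
Lemma charge_edge e : e \in F -> \sum_(v in ends e) charge v e < 0.
Proof.
move=> eF; have x0 := x_gt0 eF.
have /eqP/cards2P[u [v [uv euv]]] := ends2 eF.
have ue : u \in ends e by rewrite euv !inE eqxx.
have ve : v \in ends e by rewrite euv !inE eqxx orbT.
have sumuv (f : V -> R) : \sum_(w in ends e) f w = f u + f v.
  by rewrite euv big_setU1 ?inE //= big_set1.
have := crowded_slack eF; rewrite sumuv => C.
have su := slack_ge0 u; have sv := slack_ge0 v.
have du := degree1_load eF ue; have dv := degree1_load eF ve.
have Du := degree2_slack eF ue; have Dv := degree2_slack eF ve.
have {}du : (degree u <= 1)%N -> slack u = 1 - x e.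
  by move=> d1; rewrite /slack du.
have {}dv : (degree v <= 1)%N -> slack v = 1 - x e.
  by move=> d1; rewrite /slack dv.
rewrite sumuv /charge sumuv /excess.
move: (slack u) (slack v) (x e) x0 C su sv du dv Du Dv => s t y.
case: (leqP (degree u) 1) => u1; case: (leqP (degree v) 1) => v1.
- move=> x0 C su sv du dv _ _; have := du isT; have := dv isT; lra.
- case: eqP => v2 x0 C su sv du _ _ Dv; have {}du := du isT.
    have := Dv v2; lra.
  have : 7 + 5 * t < 9 * s by lra.
  by move/(leaf_charge sv); lra.
- case: eqP => u2 x0 C su sv _ dv Du _; have {}dv := dv isT.
    have := Du u2; lra.
  have : 7 + 5 * s < 9 * t by lra.
  by move/(leaf_charge su); lra.
case: eqP => u2; case: eqP => v2 x0 C su sv _ _ Du Dv.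
- have := Du u2; have := Dv v2; lra.
- have := degree2_charge su sv; lra.
- have := degree2_charge sv su; lra.
(* [excess] is least at slack [3 / 10], where it is [- 9 / 20], so both charges are negative. *)
- have := sqr_ge0 (s - 3 / 10); have := sqr_ge0 (t - 3 / 10); lra.
Qed.

Lemma discharging : F != set0 ->
  \sum_v load v * (7 - 5 * load v) < 2 * #|F|%:R.
Proof.
case/set0Pn => e0 e0F.
have deg : \sum_v (degree v)%:R = 2 * #|F|%:R :> R.
  under eq_bigr do rewrite -[_%:R]mulr1 -sum_degree.
  rewrite (exchange_big_dep (mem F)) /=; last by move=> v e _ /andP[].
  rewrite (eq_bigr (fun=> 2)) => [|e eF]; first by rewrite sumr_const mulr_natr.
  under eq_bigl do rewrite eF /=.
  by rewrite sumr_const ends2.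
rewrite -deg -subr_lt0 -sumrB.
apply: le_lt_trans (ler_sum _ (fun v _ => charge_degree v)) _.
rewrite (exchange_big_dep (mem F)) /=; last by move=> v e _ /andP[].
have neg e : e \in F -> \sum_(v | (e \in F) && (v \in ends e)) charge v e < 0.
  by move=> eF; under eq_bigl do rewrite eF /=; apply: charge_edge.
rewrite (bigD1 e0) //=; apply: ltr_nwDl; first exact: neg.
by apply: sumr_le0 => e /andP[/neg/ltW].
Qed.
End Discharging.

(** * Fractional matchings and their extreme points *)

Lemma fractional_matching_le1 (R : numDomainType) (V : finType)
    (H : hypergraph V) (x : {ffun edge H -> R}) :
  (forall e, 0 <= x e) ->
  (forall v : V, \sum_(e : edge H | v \in val e) x e <= 1) ->
  fractional_matching x.
Proof.
move=> x0 xv; split=> // e; rewrite x0 /=.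
have /set0Pn[v ve] : val e != set0.
  by apply: contraNneq (edges_nonempty H) => <-; apply: valP.
apply: le_trans (xv v); rewrite (bigD1 e) //= lerDl.
by apply: sumr_ge0.
Qed.

(** Otherwise some nonzero [y] on the support has sum 0 at every tight vertex, and [x] is the
    midpoint of the fractional matchings [x + eps * y] and [x - eps * y]. *)
Lemma support_le_tight (R : realFieldType) (V : finType) (H : hypergraph V)
    (x : {ffun edge H -> R}) : basic_fractional_matching x ->
  (#|[set e | (0 < x e)%R]| <=
   #|[set v : V | (\sum_(e : edge H | v \in val e) x e == 1)%R]|)%N.
Proof.
case=> -[x01 xv] ext; rewrite leqNgt; apply/negP.
have x0 e : 0 <= x e by case/andP: (x01 e).
move/(underdetermined_kernel (fun (e : edge H) v => (v \in val e)%:R : R)).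
case=> y [[e ye] yP yT].
pose Y v := \sum_(e : edge H | v \in val e) y e.
(* [c] lists the slacks of all constraints at [x], and [w] their rates of change along [y], up to
   sign. *)
pose c (i : edge H + V) := match i with
  | inl e => x e | inr v => 1 - \sum_(e : edge H | v \in val e) x e end.
pose w (i : edge H + V) := match i with inl e => y e | inr v => Y v end.
have [||eps eps0 epsP] := @exists_uniform_scale _ _ c w.
- by case=> [f|v] //=; rewrite subr_ge0.
- case=> [f|v] /= c0; first by rewrite yP // inE c0 ltxx.
  rewrite -[RHS](yT v); last by rewrite inE eq_sym -subr_eq0 c0.
  rewrite /Y big_mkcond; apply: eq_bigr => f _.
  by case: (v \in val f); rewrite ?mulr1 ?mulr0.
pose z t : {ffun edge H -> R^o} := [ffun f => x f + t * y f].
have zP t : `|t| = eps -> fractional_matching (z t : {ffun edge H -> R}).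
  move=> te; apply: fractional_matching_le1 => [f|v].
    have := epsP (inl f); rewrite /= -te -normrM ffunE ler_norml => /andP[? _].
    by rewrite -lerBlDl sub0r.
  have := epsP (inr v); rewrite /= -te -normrM ler_norml => /andP[_ ?].
  under eq_bigr do rewrite ffunE.
  by rewrite big_split /= -mulr_sumr -lerBrDl.
have [||||zx _] := ext (z eps) (z (- eps)) (1 / 2).
- by apply: zP; rewrite gtr0_norm.
- by apply: zP; rewrite normrN gtr0_norm.
- by apply/andP; split; lra.
- by apply/ffunP => f; rewrite !ffunE /GRing.scale /=; field.
have /ffunP/(_ e) := zx; rewrite ffunE => /eqP.
by rewrite addrC -subr_eq0 addrK mulf_eq0 (negPf ye) gt_eqF.
Qed.

(** The double sum counts [e] exactly [#|val e|] times and each neighbor at least once. *)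
Lemma neighborhood_sum_le (R : numDomainType) (V : finType) (H : hypergraph V)
    (h : edge H -> R) (e : edge H) : (forall f, 0 <= h f) ->
  \sum_(f in neighbors e) h f + #|val e|%:R * h e <=
  \sum_(v in val e) \sum_(f : edge H | v \in val f) h f.
Proof.
move=> h0; rewrite (exchange_big_dep predT) //= [leRHS](bigD1 e) //=.
rewrite [leLHS]addrC; apply: lerD.
  rewrite (eq_bigl (mem (val e))) => [|v]; last by rewrite andbb.
  by rewrite sumr_const mulr_natl.
rewrite big_mkcond [leRHS]big_mkcond; apply: ler_sum => f _.
rewrite inE; case: ifP => [/andP[-> /set0Pn[v]]|_].
  rewrite inE => /andP[vf ve]; rewrite (bigD1 v) /= ?ve //.
  by rewrite lerDl sumr_ge0.
by case: ifP => // _; rewrite sumr_ge0.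
Qed.

(** * Weighted counting over pairs and triples *)

Lemma no_pairs_triples (R : realFieldType) (V E : finType) (ends : E -> {set V})
    (x : E -> R) (P T : {set E}) :
  let d v := load ends x P v + load ends x T v in
  let m v := 9 * d v + 5 * load ends x P v in
  (forall e, e \in P -> #|ends e| = 2) ->
  (forall e, e \in T -> #|ends e| = 3) ->
  (forall e, e \in P -> 0 < x e) ->
  (forall e, e \in T -> 0 < x e) ->
  (forall v, d v <= 1) ->
  (forall e, e \in P -> 21 + 14 * x e < \sum_(v in ends e) m v) ->
  (forall e, e \in T -> 21 + 18 * x e < \sum_(v in ends e) m v) ->
  (#|P| + #|T| <= #|[set v | (d v == 1)%R]|)%N ->
  P = set0 /\ T = set0.
Proof.
move=> d m P2 T3 xP xT d1 crowdedP crowdedT tight.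
pose a := load ends x P; pose b := load ends x T.
have a0 v : 0 <= a v by apply: load_ge0.
have b0 v : 0 <= b v by apply: load_ge0.
have {}d1 v : a v + b v <= 1 by apply: d1.
(* The sum exceeds [x e * (18 * x e - 12) + 2 = 18 * (x e - 1 / 3) ^+ 2]. *)
have triple e : e \in T -> 0 < \sum_(v in ends e) x e * (m v - 11) + 2.
  move=> eT; rewrite -mulr_sumr sumrB sumr_const T3 //.
  have : 0 < x e * (\sum_(v in ends e) m v - (21 + 18 * x e)).
    by rewrite mulr_gt0 ?subr_gt0 ?xT ?crowdedT.
  have := sqr_ge0 (x e - 1 / 3); lra.
have sumT : \sum_(e in T) (\sum_(v in ends e) x e * (m v - 11) + 2) =
    \sum_v b v * (m v - 11) + 2 * #|T|%:R.
  rewrite big_split /= sumr_const mulr_natr; congr (_ + _).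
  rewrite (exchange_big_dep predT) //=; apply: eq_bigr => v _.
  by rewrite -mulr_suml.
(* Equality holds at a tight vertex, where [b v = 1 - a v] and [m v = 9 + 5 * a v]. *)
have vertex v : b v * (m v - 11) + 2 * (d v == 1)%:R <= a v * (7 - 5 * a v).
  have := a0 v; have := b0 v; have := d1 v.
  rewrite /m /d -/a -/b; case: eqP => /=; nra.
have : \sum_v b v * (m v - 11) + 2 * (#|P| + #|T|)%:R <=
    \sum_v a v * (7 - 5 * a v).
  apply: le_trans (ler_sum _ (fun v _ => vertex v)).
  rewrite big_split /= lerD2l -mulr_sumr ler_wpM2l // -natr_sum ler_nat.
  apply: leq_trans tight _; rewrite -sum1_card big_mkcond leq_sum // => v _.
  by rewrite inE; case: eqP.
rewrite natrD mulrDr => total.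
(* Without pairs the right side of [total] is 0, while a single triple would make its left side
   positive. *)
have [P0|Pn] := eqVneq P set0.
  split=> //; apply/eqP; apply: contraT => /set0Pn[e eT].
  have : \sum_v a v * (7 - 5 * a v) = 0.
    apply: big1 => v _; rewrite /a /load P0 big_pred0 ?mul0r // => f.
    by rewrite inE.
  have : 0 < \sum_(e in T) (\sum_(v in ends e) x e * (m v - 11) + 2).
    rewrite (bigD1 e) //= ltr_pwDl ?triple // sumr_ge0 // => f /andP[fT _].
    exact/ltW/triple.
  move: total; rewrite sumT P0 cards0; lra.
exfalso.
have : 0 <= \sum_(e in T) (\sum_(v in ends e) x e * (m v - 11) + 2).
  by apply: sumr_ge0 => e /triple/ltW.
have : \sum_v a v * (7 - 5 * a v) < 2 * #|P|%:R.
  apply: discharging => // [v|e eP].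
    by have := d1 v; have := b0 v; rewrite -/(a v); lra.
  have := crowdedP _ eP.
  (* Bounding [d v] by 1 at both ends lowers the constant 21 to the 3 that discharging expects. *)
  have : \sum_(v in ends e) m v <= \sum_(v in ends e) (9 + 5 * a v).
    apply: ler_sum => v _; rewrite lerD2r.
    by have := d1 v; rewrite /d -/(a v) -/(b v); lra.
  rewrite [leRHS]big_split /= sumr_const P2 // -mulr_sumr -/a; lra.
rewrite sumT; lra.
Qed.

Theorem theorem9 (R : realType) (V : finType) (H : hypergraph V)
  (rankH : rank H = 3%N) :
  good H (fun e : {set V} => 1 / (#|e|%:R - 1 + 1 / #|e|%:R) : R).
Proof.
move=> H' /subsetP sub /set0Pn[e0 e0H] [x [basic_x stuck_x]].
have [[x01 xv] _] := basic_x.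
have x0 e : 0 <= x e by case/andP: (x01 e).
have size_edge (e : edge H') : #|val e| = 1 \/ #|val e| = 2 \/ #|val e| = 3.
  have : (#|val e| <= 3)%N.
    by rewrite -rankH /rank (bigD1 (val e)) ?leq_maxl //; apply/sub/valP.
  have : (0 < #|val e|)%N.
    rewrite card_gt0; apply: contraNneq (edges_nonempty H') => <-.
    exact: valP.
  by case: #|val e| => [|[|[|[|]]]] //; auto.
pose g (e : {set V}) : R := 1 / (#|e|%:R - 1 + 1 / #|e|%:R).
have g1 (e : {set V}) : #|e| = 1 -> g e = 1 by rewrite /g => ->; field.
have g2 (e : {set V}) : #|e| = 2 -> g e = 2 / 3 by rewrite /g => ->; field.
have g3 (e : {set V}) : #|e| = 3 -> g e = 3 / 7 by rewrite /g => ->; field.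
have g01 (e : edge H') : 0 <= g (val e) <= 1.
  by case: (size_edge e) => [/g1|[/g2|/g3]] ->; apply/andP; split; lra.
pose h (e : edge H') := g (val e) * x e.
have h0 e : 0 <= h e by rewrite mulr_ge0 //; case/andP: (g01 e).
have crowded e : 1 - h e + #|val e|%:R * h e <
    \sum_(v in val e) \sum_(f : edge H' | v \in val f) h f.
  apply: lt_le_trans (neighborhood_sum_le e h0).
  by rewrite ltrD2r; apply: stuck_x.
(* At a singleton edge, stuckness would force a load above 1 at its vertex, since [h <= x]. *)
have no_loop (e : edge H') : #|val e| <> 1.
  move=> e1; have := crowded e; rewrite e1 mul1r subrK.
  have /eqP/cards1P[v ->] := e1; rewrite big_set1; apply/negP; rewrite -leNgt.
  apply: le_trans (xv v); apply: ler_sum => f _.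
  by rewrite ler_piMl //; case/andP: (g01 f).
pose P := [set e : edge H' | (#|val e| == 2) && (0 < x e)].
pose T := [set e : edge H' | (#|val e| == 3) && (0 < x e)].
have split_sum (k : edge H' -> R) v : (forall e, x e = 0 -> k e = 0) ->
    \sum_(e : edge H' | v \in val e) k e =
    \sum_(e in P | v \in val e) k e + \sum_(e in T | v \in val e) k e.
  move=> k0; rewrite big_mkcond [in RHS]big_mkcond [X in _ = _ + X]big_mkcond.
  rewrite -big_split; apply: eq_bigr => e _ /=; rewrite !inE.
  have := x0 e; rewrite le_eqVlt => /predU1P[/esym/k0 ->|->].
    by rewrite !if_same addr0.
  case: (size_edge e) => [/no_loop//|[->|->]] /=.
    by rewrite addr0.
  by rewrite add0r.
have size_neq0 (k : {set V} -> R) e : x e = 0 -> k (val e) * x e = 0.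
  by move=> ->; rewrite mulr0.
(* The common denominator 21 makes [21 * g] equal to [14 = 9 + 5] on pairs and to 9 on triples. *)
have mass v : 9 * (load val x P v + load val x T v) + 5 * load val x P v =
    21 * \sum_(e : edge H' | v \in val e) h e.
  rewrite split_sum; last exact: (size_neq0 g).
  rewrite (eq_bigr (fun e => 2 / 3 * x e)) => [|e]; last first.
    by rewrite inE => /andP[/andP[/eqP/g2 ge _] _]; rewrite /h ge.
  rewrite [X in _ = _ * (_ + X)](eq_bigr (fun e => 3 / 7 * x e)) => [|e]; last first.
    by rewrite inE => /andP[/andP[/eqP/g3 ge _] _]; rewrite /h ge.
  rewrite -!mulr_sumr -/(load val x P v) -/(load val x T v); lra.
have [|||||||| P0 T0] := @no_pairs_triples R V _ val x P T.
- by move=> e; rewrite inE => /andP[/eqP].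
- by move=> e; rewrite inE => /andP[/eqP].
- by move=> e; rewrite inE => /andP[].
- by move=> e; rewrite inE => /andP[].
- by move=> v; rewrite -split_sum.
- move=> e; rewrite inE => /andP[/eqP e2 _].
  rewrite (eq_bigr _ (fun v _ => mass v)) -mulr_sumr.
  by have := crowded e; rewrite e2 /h g2 //; lra.
- move=> e; rewrite inE => /andP[/eqP e3 _].
  rewrite (eq_bigr _ (fun v _ => mass v)) -mulr_sumr.
  by have := crowded e; rewrite e3 /h g3 //; lra.
- rewrite -cardsUI (_ : P :&: T = set0) ?cards0 ?addn0; last first.
    by apply/setP => e; rewrite !inE; case: eqP => // ->; rewrite andbF.
  have PT : P :|: T \subset [set e : edge H' | 0 < x e].
    by apply/subsetP => e; rewrite !inE -andb_orl => /andP[].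
  apply: leq_trans (subset_leq_card PT) _.
  apply: leq_trans (support_le_tight basic_x) _.
  by apply/subset_leq_card/subsetP => v; rewrite !inE split_sum.
have h_eq0 (f : edge H') : h f = 0.
  apply: size_neq0; apply: contraTeq isT => xf.
  have {}xf : 0 < x f by rewrite lt_neqAle eq_sym xf x0.
  case: (size_edge f) => [/no_loop//|[f2|f3]].
    by have /setP/(_ f) := P0; rewrite !inE f2 xf.
  by have /setP/(_ f) := T0; rewrite !inE f3 xf.
(* With [h] zero everywhere, stuckness at [e0] reads [1 < 0]. *)
have := crowded (exist _ e0 e0H); rewrite !h_eq0 mulr0 addr0 subr0.
by rewrite big1 ?ltr10 // => v _; apply: big1.
Qed.
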